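(* Cooperative inference is robust to any amount of off-diagonal perturbation: let $\mathbf{M}=(m_{ij})\in\mathcal{A}$ and let $\mathbf{M}'=(m'_{ij})\in\mathcal{A}$ be a matrix of the same size obtained from $\mathbf{M}$ by changing (by any amounts) the values of some entries, such that for every position $(s,t)$ with $m'_{st}\ne m_{st}$, the entry $m_{st}$ is an off-diagonal element of $\mathbf{M}$ and the entry $m'_{st}$ is an off-diagonal element of $\mathbf{M}'$. Then $\Phi(\mathbf{M}')=\Phi(\mathbf{M})$, and hence $\mathrm{CI}(\mathbf{M}')=\mathrm{CI}(\mathbf{M})$.
   Context: All matrices are real, non-negative and have no zero rows or zero columns. For an $n\times n$ matrix $A=(a_{ij})$ and $\sigma\in S_n$, the set $\{a_{1,\sigma(1)},\dots,a_{n,\sigma(n)}\}$ is the diagonal of $A$ determined by $\sigma$; it is positive if all $a_{i,\sigma(i)}>0$. An entry of $A$ (at position $(i_0,j_0)$) is called on-diagonal if it is contained in a positive diagonal, i.e. some $\sigma$ with $\sigma(i_0)=j_0$ determines a positive diagonal; otherwise it is called off-diagonal (an off-diagonal entry may be positive). $\mathcal{A}$ is the set of $n\times n$ matrices that have at least one positive diagonal. Sinkhorn (SK) iteration of $\mathbf{M}$ alternately normalizes rows (dividing each row by its sum) and columns (dividing each column by its sum), starting with rows. By Sinkhorn and Knopp, for $\mathbf{M}\in\mathcal{A}$ it converges to a unique doubly stochastic matrix $\mathbf{M}^*=(m^*_{ij})$; $\Phi(\mathbf{M})=\mathbf{M}^*$. The cooperative index of $\mathbf M\in\mathcal A$ is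 $\mathrm{CI}(\mathbf{M})=\frac1n\sum_{i,j}(m^*_{ij})^2$. *)

(* Defs.v *)
From HB Require Import structures.
From mathcomp Require Import all_boot all_order all_algebra all_fingroup.
From mathcomp Require Import all_classical all_reals all_analysis.

Set Implicit Arguments.
Unset Strict Implicit.
Unset Printing Implicit Defensive.

Import Order.TTheory GRing.Theory Num.Theory.
Import numFieldTopology.Exports numFieldNormedType.Exports.

Local Open Scope classical_set_scope.
Local Open Scope ring_scope.

Section Sinkhorn.
Variables (R : realType) (n : nat).
Implicit Types M : 'M[R]_n.

Definition nonneg_mx M : Prop := forall i j, 0 <= M i j.

Definition no_zero_row_col M : Prop :=
  (forall i, exists j, M i j <> 0) /\ (forall j, exists i, M i j <> 0).

Definition positive_diagonal M (s : 'S_n) : Prop := forall i, 0 < M i (s i).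

(* On/off-diagonal is a property of the position, so an off-diagonal entry may
   well be positive. *)
Definition on_diagonal M (i0 j0 : 'I_n) : Prop :=
  exists s : 'S_n, s i0 = j0 /\ positive_diagonal M s.

Definition off_diagonal M (i0 j0 : 'I_n) : Prop := ~ on_diagonal M i0 j0.

Definition class_A M : Prop :=
  [/\ nonneg_mx M, no_zero_row_col M & exists s, positive_diagonal M s].

Definition row_normalize M : 'M[R]_n :=
  \matrix_(i, j) (M i j / \sum_k M i k).

Definition col_normalize M : 'M[R]_n :=
  \matrix_(i, j) (M i j / \sum_k M k j).

(* Each step is a single normalization: the step out of an even-indexed iterate
   acts on rows, the step out of an odd-indexed one on columns. *)
Fixpoint sinkhorn_iter M (k : nat) : 'M[R]_n :=
  if k is k'.+1 then
    if odd k' then col_normalize (sinkhorn_iter M k')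
    else row_normalize (sinkhorn_iter M k')
  else M.

(* [lim] is total, with a default value on divergent sequences; on [class_A] the
   iteration converges by the Sinkhorn-Knopp theorem. *)
Definition Phi M : 'M[R]_n := lim (sinkhorn_iter M @ \oo).

Definition CI M : R := n%:R^-1 * \sum_i \sum_j (Phi M i j) ^+ 2.

End Sinkhorn.

(* Main.v *)
Require Import Defs.
From HB Require Import structures.
From mathcomp Require Import all_boot all_order all_algebra all_fingroup.
From mathcomp Require Import all_classical all_reals all_analysis.

Set Implicit Arguments.
Unset Strict Implicit.
Unset Printing Implicit Defensive.

Import Order.TTheory GRing.Theory Num.Theory.
Local Open Scope ring_scope.

(** A permutation meeting an altered position determines a positive diagonal of
    neither matrix, so M and M' have the same product along every diagonal.
    Each Sinkhorn step divides all diagonal products by a common factor, the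
    product of the sums being normalized, which after the first step is at most
    1 by AM-GM. Positive diagonal products therefore increase to positive
    limits, and those factors tend to 1, which by the equality case of AM-GM
    makes the limit of the iterates along any ultrafilter doubly stochastic,
    with diagonal products proportional to those of M. A doubly stochastic
    matrix is determined by its diagonal products up to a common factor, so all
    these limits, for M and for M', agree. *)

(** * Matrices with equal row and column sums *)

(** A permutation with as many positive entries as possible works: if one of its entries vanished,
    an alternating cycle would improve it. *)
Lemma regular_positive_diagonal (R : realType) n (A : 'M[R]_n) c :
  0 < c -> nonneg_mx A -> (forall i, \sum_j A i j = c) ->
  (forall j, \sum_i A i j = c) -> exists s, positive_diagonal A s.
Proof.
move=> c0 A0 Ar Ac.
pose P (t : 'S_n) := [set i | 0 < A i (t i)]%SET.
have [s _ smax] := @arg_maxnP 'S_n 1%g xpredT (fun t => #|P t|) isT.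
exists s => i0; apply: contrapT => /negP si0.
(* The rows reachable from [i0] along [e] exhaust the mass of their images under
   [s], so some edge returns to [i0]; rotating [s] along the resulting cycle
   makes one more entry positive. *)
pose e := [rel i k | 0 < A i (s k)].
pose Z := connect e i0.
have AZ i k : Z i -> ~~ Z k -> A i (s k) = 0.
  move=> Zi nZk; apply/eqP; rewrite eq_le A0 andbT leNgt; apply: contra nZk => eik.
  exact: connect_trans Zi (connect1 eik).
have AZ' : \sum_(k | Z k) \sum_(i | ~~ Z i) A i (s k) = 0.
  have: \sum_(k | Z k) \sum_(i | Z i) A i (s k) = \sum_(k | Z k) c.
    rewrite exchange_big /=; apply: eq_bigr => i Zi.
    rewrite -[RHS](Ar i) [RHS](reindex_inj (@perm_inj _ s)) /= [RHS](bigID Z) /=.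
    by rewrite [X in _ + X]big1 ?addr0 // => k; exact: AZ.
  have: \sum_(k | Z k) \sum_i A i (s k) = \sum_(k | Z k) c.
    by apply: eq_bigr => k _; exact: Ac.
  move=> <-.
  under [X in _ = X -> _]eq_bigr do rewrite (bigID Z) /=.
  by rewrite big_split /= -[X in X = _ -> _]addr0 => /addrI <-.
have [i1 Ai1] : exists i1, 0 < A i1 (s i0).
  apply: contrapT => nA; move: (c0); rewrite -(Ac (s i0)) big1 ?ltxx// => i _.
  apply/eqP; rewrite eq_le A0 andbT leNgt; apply/negP => ?; apply: nA.
  by exists i.
have Zi1 : Z i1.
  apply: contraT => nZ; move: Ai1; rewrite lt_neqAle => /andP[/eqP + _]; case.
  have S0 k : Z k -> 0 <= \sum_(i | ~~ Z i) A i (s k).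
    by move=> _; apply: sumr_ge0.
  have := psumr_eq0P S0 AZ' (connect0 e i0).
  by move/psumr_eq0P => ->.
(* Without repetitions on the path, [next] is injective; off the cycle it is the identity, so [s] is
   unchanged there. *)
case/connectP: Zi1 => p' /shortenP[p pth up _] i1E.
have ce : path.cycle e (i0 :: p) by rewrite /= rcons_path pth -i1E.
pose nx := next (i0 :: p).
have inj_nx : injective (fun i => s (nx i)).
  by apply: inj_comp perm_inj (can_inj (prev_next up)).
have : (#|P s| < #|P (perm inj_nx)|)%N.
  apply/proper_card/properP; split; last first.
    exists i0; rewrite !inE ?permE//.
    exact: (next_cycle ce (mem_head _ _)).
  apply/fintype.subsetP => i; rewrite !inE permE.
  have [ip _|nip] := boolP (i \in i0 :: p); first exact: (next_cycle ce ip).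
  by rewrite /nx next_nth (negbTE nip).
by rewrite ltnNge; move/negP; apply; exact: smax.
Qed.

(* Birkhoff's theorem in dual form: by induction on the support, a positive
   multiple of the permutation matrix of a positive diagonal is subtracted. *)
Lemma sum_mul_regular (R : realType) n (A : 'M[R]_n) c (h : 'I_n -> 'I_n -> R) a :
  (0 < n)%N -> 0 <= c -> nonneg_mx A -> (forall i, \sum_j A i j = c) ->
  (forall j, \sum_i A i j = c) ->
  (forall s, positive_diagonal A s -> \sum_i h i (s i) = a) ->
  \sum_i \sum_j A i j * h i j = c * a.
Proof.
move=> n0; have [m] := ubnP #|[set p : 'I_n * 'I_n | 0 < A p.1 p.2]%SET|.
elim: m A c => // m IH A c /ltnSE lem c0 A0 Ar Ac hA.
move: c0; rewrite le_eqVlt => /predU1P[c0|c0].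
  rewrite -c0 mul0r big1// => i _; rewrite big1// => j _.
  have Ai0 : \sum_j A i j = 0 by rewrite Ar -c0.
  by rewrite (psumr_eq0P _ Ai0)// mul0r.
have [s sA] := regular_positive_diagonal c0 A0 Ar Ac.
(* Subtracting the least entry of the diagonal keeps [B] nonnegative and empties the position
   [(i0, s i0)], so the support shrinks. *)
have [i0 _ i0min] := @arg_minP _ _ _ (Ordinal n0) xpredT (fun i => A i (s i)) isT.
set b := A i0 (s i0) in i0min.
have b0 : 0 < b by exact: sA.
pose B := \matrix_(i, j) (A i j - b * (s i == j)%:R).
have sr i : \sum_j (s i == j)%:R = 1 :> R.
  by rewrite (bigD1 (s i))//= eqxx big1 ?addr0// => j /negbTE; rewrite eq_sym => ->.
have sc j : \sum_i (s i == j)%:R = 1 :> R.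
  rewrite (reindex_inj (@perm_inj _ s^-1%g)) -[RHS](sr (s^-1%g j)).
  by apply: eq_bigr => i _; rewrite !permKV eq_sym.
have B0 : nonneg_mx B.
  move=> i j; rewrite mxE; case: eqP => [<-|_]; last by rewrite mulr0 subr0.
  by rewrite mulr1 subr_ge0 i0min.
have BA i j : B i j <= A i j.
  by rewrite mxE gerBl mulr_ge0// ltW.
have Br i : \sum_j B i j = c - b.
  under eq_bigr do rewrite mxE.
  by rewrite sumrB -mulr_sumr sr mulr1 Ar.
have Bc j : \sum_i B i j = c - b.
  under eq_bigr do rewrite mxE.
  by rewrite sumrB -mulr_sumr sc mulr1 Ac.
have cb0 : 0 <= c - b by rewrite -(Br i0); apply: sumr_ge0.
have : \sum_i \sum_j B i j * h i j = (c - b) * a.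
  apply: IH => //.
    apply: leq_trans lem; apply/proper_card/properP; split.
      by apply/fintype.subsetP => -[i j]; rewrite !inE /= => /lt_le_trans; apply.
    by exists (i0, s i0); rewrite !inE /= ?sA// mxE eqxx mulr1 subrr ltxx.
  by move=> t tB; apply: hA => i; exact: lt_le_trans (tB i) _.
rewrite mulrBl -[in X in _ - X](hA s sA) [in X in _ - X]mulr_sumr => E.
apply: (subIr (\sum_i b * h i (s i))).
rewrite /= -E -sumrB; apply: eq_bigr => i _.
rewrite (bigD1 (s i))//= [in RHS](bigD1 (s i))//= !mxE eqxx mulr1 mulrBl addrAC.
congr (_ + _); apply: eq_bigr => j /negbTE; rewrite eq_sym mxE => ->.
by rewrite mulr0 subr0.
Qed.

(** * Doubly stochastic matrices and their diagonal products *)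

Lemma ln_prod (R : realType) (I : finType) (F : I -> R) :
  (forall i, 0 < F i) -> ln (\prod_i F i) = \sum_i ln (F i).
Proof.
move=> F0; suff: 0 < \prod_i F i /\ ln (\prod_i F i) = \sum_i ln (F i) by case.
elim/big_rec2: _ => [|i x y _ [y0 yE]]; first by rewrite ln1.
by rewrite mulr_gt0 ?F0// lnM ?posrE ?F0// yE.
Qed.

Lemma positive_diagonalE (R : realType) n (A : 'M[R]_n) (s : 'S_n) :
  nonneg_mx A -> (0 < \prod_i A i (s i)) <-> positive_diagonal A s.
Proof.
move=> A0; split=> [|sA]; last by apply: prodr_gt0 => i _; exact: sA.
rewrite lt_neqAle => /andP[+ _] i; rewrite eq_sym => /prodf_neq0/(_ i isT) Ai.
by rewrite lt_neqAle eq_sym Ai A0.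
Qed.

Definition doubly_stochastic (R : realType) n (A : 'M[R]_n) :=
  [/\ nonneg_mx A, forall i, \sum_j A i j = 1 & forall j, \sum_i A i j = 1].

(** Apply the dual Birkhoff identity to the indicator of [(i, j)]: if no positive diagonal met this
    position, its sum against [A], which is [A i j], would be 0. *)
Lemma doubly_stochastic_on_diagonal (R : realType) n (A : 'M[R]_n) i j :
  doubly_stochastic A -> 0 < A i j -> on_diagonal A i j.
Proof.
move=> [A0 Ar Ac] Aij; apply: contrapT => nA.
have n0 : (0 < n)%N by exact: leq_ltn_trans (ltn_ord i).
have : \sum_k \sum_l A k l * ((k == i) && (l == j))%:R = 1 * 0.
  apply: (sum_mul_regular n0 ler01 A0 Ar Ac) => s sA.
  rewrite big1// => k _; case: eqP => // ->; case: eqP => // sij.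
  by case: nA; exists s.
rewrite mulr0 => /psumr_eq0P/(_ i isT).
rewrite (bigD1 j)//= !eqxx mulr1 big1 => [|l /negbTE ->]; last by rewrite andbF mulr0.
rewrite addr0 => Aij0; rewrite Aij0 ?ltxx// in Aij.
by move=> k _; apply: sumr_ge0 => l _; rewrite mulr_ge0.
Qed.

Lemma subr_mul_ln_ge0 (R : realType) (x y : R) :
  0 < x -> 0 < y -> 0 <= (x - y) * (ln x - ln y) ?= iff (x == y).
Proof.
move=> x0 y0; split.
  case: (leP x y) => xy; first by rewrite mulr_le0// subr_le0// ler_ln.
  by rewrite mulr_ge0// subr_ge0 ?ler_ln// ltW.
rewrite eq_sym mulf_eq0 !subr_eq0 orb_idr// => /eqP/ln_inj -> //.
Qed.

(* With [h = ln A - ln B], which sums to [- ln d] along every positive diagonal,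
   both [\sum A * h] and [\sum B * h] equal [- ln d]; so the nonnegative terms
   [(A - B) * (ln A - ln B)] sum to zero. *)
Lemma doubly_stochastic_eq (R : realType) n (A B : 'M[R]_n) d :
  0 < d -> doubly_stochastic A -> doubly_stochastic B ->
  (forall s : 'S_n, \prod_i B i (s i) = d * \prod_i A i (s i)) -> A = B.
Proof.
move=> d0 dA dB ABd; have [A0 Ar Ac] := dA; have [B0 Br Bc] := dB.
have posAB s : positive_diagonal A s <-> positive_diagonal B s.
  by rewrite -!positive_diagonalE// ABd pmulr_rgt0.
(* Positive diagonals are common to [A] and [B] and cover both supports. *)
have AB i j : (0 < A i j) = (0 < B i j).
  apply/idP/idP => /doubly_stochastic_on_diagonal.
    by move=> /(_ dA)[s [<- /posAB]].
  by move=> /(_ dB)[s [<- /posAB]].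
apply/matrixP => i j.
have n0 : (0 < n)%N by exact: leq_ltn_trans (ltn_ord i).
pose h k l := ln (A k l) - ln (B k l).
have hA s : positive_diagonal A s -> \sum_k h k (s k) = - ln d.
  move=> sA; have sB := (posAB s).1 sA.
  rewrite sumrB -(ln_prod sA) -(ln_prod sB) ABd lnM ?posrE//.
    by rewrite opprD addrCA subrr addr0.
  exact/positive_diagonalE.
have hB s : positive_diagonal B s -> \sum_k h k (s k) = - ln d.
  by move/posAB; exact: hA.
have h0 k l : 0 <= (A k l - B k l) * h k l ?= iff (A k l == B k l).
  (* Off the common support both entries are 0, so the conventional value of [ln 0] does no harm. *)
  have [Akl|nAkl] := boolP (0 < A k l).
    by apply: subr_mul_ln_ge0 => //; rewrite -AB.
  have /eqP Akl : A k l == 0 by rewrite eq_le A0 leNgt nAkl.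
  have /eqP Bkl : B k l == 0 by rewrite eq_le B0 leNgt -AB nAkl.
  by rewrite /h Akl Bkl !subrr mulr0; split; rewrite ?lexx ?eqxx.
have : \sum_k \sum_l (A k l - B k l) * h k l = 0.
  transitivity (\sum_k \sum_l A k l * h k l - \sum_k \sum_l B k l * h k l).
    rewrite -sumrB; apply: eq_bigr => k _; rewrite -sumrB.
    by apply: eq_bigr => l _; rewrite mulrBl.
  rewrite (sum_mul_regular n0 ler01 A0 Ar Ac hA).
  by rewrite (sum_mul_regular n0 ler01 B0 Br Bc hB) subrr.
have h0' k l : 0 <= (A k l - B k l) * h k l by case: (h0 k l).
move/psumr_eq0P => /(_ (fun k _ => sumr_ge0 _ (fun l _ => h0' k l)) i isT).
move/psumr_eq0P => /(_ (fun l _ => h0' i l) j isT) /esym/eqP.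
by rewrite (h0 i j).2 => /eqP.
Qed.

(** * Normalization steps and the AM-GM inequality *)

Lemma prod_le1 (R : realType) n (r : 'I_n -> R) :
  (forall i, 0 <= r i) -> \sum_i r i = n%:R ->
  \prod_i r i <= 1 ?= iff [forall i, r i == 1].
Proof.
(* The mean is a division by [n], so the empty product is treated apart. *)
case: (posnP n) r => [->|n0] r r0 rn.
  by rewrite big_ord0; split; rewrite ?lexx// eqxx; apply/esym/forallP => -[].
have := @leif_AGM R _ 'I_n r (fun i _ => r0 i).
rewrite rn card_ord divff ?pnatr_eq0 ?lt0n_neq0// expr1n => -[le1 eq1].
split=> //; rewrite eq1; apply/forall_inP/forallP => [rE i|rE i _].
  have : \sum_j r j = \sum_(j < n) r i.
    by apply: eq_bigr => j _; apply/esym/eqP/(forall_inP (rE i isT)).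
  rewrite rn sumr_const card_ord -[LHS]mulr1 -[RHS]mulr_natl => /mulfI <- //.
  by rewrite pnatr_eq0 lt0n_neq0.
by apply/forall_inP => j _; rewrite (eqP (rE i)) (eqP (rE j)).
Qed.

Lemma positive_diagonal_sums (R : realType) n (A : 'M[R]_n) (s : 'S_n) :
  nonneg_mx A -> positive_diagonal A s ->
  (forall i, 0 < \sum_j A i j) /\ (forall j, 0 < \sum_i A i j).
Proof.
move=> A0 sA; split=> [i|j].
  by rewrite (bigD1 (s i))//= ltr_pwDl// sumr_ge0.
rewrite (bigD1 (s^-1%g j))//= ltr_pwDl ?sumr_ge0//.
by have := sA (s^-1%g j); rewrite permKV.
Qed.

Lemma row_normalizeP (R : realType) n (A : 'M[R]_n) (s : 'S_n) :
  nonneg_mx A -> positive_diagonal A s ->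
  [/\ nonneg_mx (row_normalize A), positive_diagonal (row_normalize A) s,
      forall i, \sum_j row_normalize A i j = 1 &
      forall t : 'S_n, \prod_i row_normalize A i (t i) =
        \prod_i A i (t i) / \prod_i \sum_j A i j].
Proof.
move=> A0 sA; have [r0 _] := positive_diagonal_sums A0 sA; split.
- by move=> i j; rewrite mxE divr_ge0// ltW.
- by move=> i; rewrite mxE divr_gt0.
- by move=> i; under eq_bigr do rewrite mxE; rewrite -mulr_suml divff ?gt_eqF.
- by move=> t; rewrite -prodf_div; apply: eq_bigr => i _; rewrite mxE.
Qed.

Lemma col_normalizeP (R : realType) n (A : 'M[R]_n) (s : 'S_n) :
  nonneg_mx A -> positive_diagonal A s ->
  [/\ nonneg_mx (col_normalize A), positive_diagonal (col_normalize A) s,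
      forall j, \sum_i col_normalize A i j = 1 &
      forall t : 'S_n, \prod_i col_normalize A i (t i) =
        \prod_i A i (t i) / \prod_j \sum_i A i j].
Proof.
move=> A0 sA; have [_ c0] := positive_diagonal_sums A0 sA; split.
- by move=> i j; rewrite mxE divr_ge0// ltW.
- by move=> i; rewrite mxE divr_gt0.
- by move=> i; under eq_bigr do rewrite mxE; rewrite -mulr_suml divff ?gt_eqF.
(* A diagonal meets each column once, so the column sums can be listed in the order of [t]. *)
- move=> t; rewrite [X in _ / X](reindex_inj (@perm_inj _ t)) -prodf_div.
  by apply: eq_bigr => i _; rewrite mxE.
Qed.

(** * Invariants of the Sinkhorn iterates *)

Lemma sinkhorn_positive (R : realType) n (M : 'M[R]_n) (s : 'S_n) k :
  nonneg_mx M -> positive_diagonal M s ->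
  nonneg_mx (sinkhorn_iter M k) /\ positive_diagonal (sinkhorn_iter M k) s.
Proof.
move=> M0 sM; elim: k => [//|k [A0 sA]] /=.
case: ifP => _; first by have [] := col_normalizeP A0 sA.
by have [] := row_normalizeP A0 sA.
Qed.

(** The parity is that of the step producing the iterate; the shift to [k.+1] skips [M] itself,
    which need not be normalized. *)
Lemma sinkhorn_sums (R : realType) n (M : 'M[R]_n) (s : 'S_n) k :
  nonneg_mx M -> positive_diagonal M s ->
  if odd k then forall j, \sum_i sinkhorn_iter M k.+1 i j = 1
  else forall i, \sum_j sinkhorn_iter M k.+1 i j = 1.
Proof.
move=> M0 sM; have [A0 sA] := sinkhorn_positive k M0 sM.
rewrite /=; case: (odd k); first by have [] := col_normalizeP A0 sA.
by have [] := row_normalizeP A0 sA.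
Qed.

Lemma sinkhorn_le1 (R : realType) n (M : 'M[R]_n) (s : 'S_n) k i j :
  nonneg_mx M -> positive_diagonal M s -> sinkhorn_iter M k.+1 i j <= 1.
Proof.
move=> M0 sM; have [A0 _] := sinkhorn_positive k.+1 M0 sM.
have := sinkhorn_sums k M0 sM; case: ifP => _.
  by move=> /(_ j) <-; rewrite (bigD1 i)//= lerDl sumr_ge0.
by move=> /(_ i) <-; rewrite (bigD1 j)//= lerDl sumr_ge0.
Qed.

(** This makes the mean row sum and the mean column sum 1, as AM-GM requires. *)
Lemma sinkhorn_total (R : realType) n (M : 'M[R]_n) (s : 'S_n) k :
  nonneg_mx M -> positive_diagonal M s ->
  \sum_i \sum_j sinkhorn_iter M k.+1 i j = n%:R.
Proof.
move=> M0 sM; have := sinkhorn_sums k M0 sM; case: ifP => _ e1.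
  rewrite exchange_big; under eq_bigr do rewrite e1.
  by rewrite sumr_const card_ord.
by under eq_bigr do rewrite e1; rewrite sumr_const card_ord.
Qed.

(** Each step scales all diagonal products alike; the crosswise form avoids quotients. *)
Lemma sinkhorn_proportional (R : realType) n (M : 'M[R]_n) (s : 'S_n) k :
  nonneg_mx M -> positive_diagonal M s -> forall t : 'S_n,
  (\prod_i sinkhorn_iter M k i (t i)) * \prod_i M i (s i) =
  (\prod_i sinkhorn_iter M k i (s i)) * \prod_i M i (t i).
Proof.
move=> M0 sM; elim: k => [t|k IH t]; first by rewrite mulrC.
have [A0 sA] := sinkhorn_positive k M0 sM.
rewrite /=; case: ifP => _.
  have [_ _ _ E] := col_normalizeP A0 sA.
  by rewrite !E mulrAC IH mulrAC.
have [_ _ _ E] := row_normalizeP A0 sA.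
by rewrite !E mulrAC IH mulrAC.
Qed.

(** After a step one of the two factors is 1, so this is the divisor of the next step whatever its
    parity. *)
Definition sums_prod (R : realType) n (A : 'M[R]_n) :=
  (\prod_i \sum_j A i j) * (\prod_j \sum_i A i j).

Lemma sums_prod_le1 (R : realType) n (A : 'M[R]_n) :
  nonneg_mx A -> \sum_i \sum_j A i j = n%:R -> sums_prod A <= 1.
Proof.
move=> A0 An; rewrite mulr_ile1 ?prodr_ge0//; try by move=> *; exact: sumr_ge0.
  by apply: prod_le1 => // i; exact: sumr_ge0.
by apply: prod_le1 => [i|]; [exact: sumr_ge0|rewrite exchange_big].
Qed.

(** Both factors are at most 1, so each equals 1, which is the equality case of AM-GM. *)
Lemma sums_prod_eq1 (R : realType) n (A : 'M[R]_n) :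
  nonneg_mx A -> \sum_i \sum_j A i j = n%:R -> sums_prod A = 1 ->
  doubly_stochastic A.
Proof.
move=> A0 An A1.
have r0 i : 0 <= \sum_j A i j by exact: sumr_ge0.
have c0 j : 0 <= \sum_i A i j by exact: sumr_ge0.
have [ler eqr] := prod_le1 r0 An.
have [lec eqc] : \prod_j \sum_i A i j <= 1 ?= iff [forall j, \sum_i A i j == 1].
  by apply: prod_le1 => //; rewrite exchange_big.
have R1 : \prod_i \sum_j A i j = 1.
  apply/eqP; rewrite eq_le ler /= -[X in X <= _]A1 /sums_prod ler_piMr//.
  by apply: prodr_ge0.
have C1 : \prod_j \sum_i A i j = 1 by rewrite -[RHS]A1 /sums_prod R1 mul1r.
split=> // i.
  by apply/eqP; move: eqr; rewrite R1 eqxx => /esym/forallP.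
by apply/eqP; move: eqc; rewrite C1 eqxx => /esym/forallP.
Qed.

Lemma sinkhorn_step (R : realType) n (M : 'M[R]_n) (s t : 'S_n) k :
  nonneg_mx M -> positive_diagonal M s ->
  \prod_i sinkhorn_iter M k.+2 i (t i) =
  \prod_i sinkhorn_iter M k.+1 i (t i) / sums_prod (sinkhorn_iter M k.+1).
Proof.
move=> M0 sM; have [A0 sA] := sinkhorn_positive k.+1 M0 sM.
(* The step out of iterate [k.+1] has the parity opposite to [k]: rows for odd [k]. *)
have -> : sinkhorn_iter M k.+2 = if odd k then row_normalize (sinkhorn_iter M k.+1)
    else col_normalize (sinkhorn_iter M k.+1).
  by rewrite -if_neg.
rewrite /sums_prod; have := sinkhorn_sums k M0 sM; case: (odd k) => e1.
  have [_ _ _ ->] := row_normalizeP A0 sA.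
  by rewrite [X in _ / (_ * X)]big1 ?mulr1.
have [_ _ _ ->] := col_normalizeP A0 sA.
by rewrite [X in _ / (X * _)]big1 ?mul1r.
Qed.

Import numFieldTopology.Exports numFieldNormedType.Exports.
Local Open Scope classical_set_scope.

(** * Convergence of the diagonal products *)

(** Divisors at most 1 make the products nondecreasing, entries at most 1 bound them, and the first
    one bounds the limit away from 0. *)
Lemma sinkhorn_diagonal_cvg (R : realType) n (M : 'M[R]_n) (s : 'S_n) :
  nonneg_mx M -> positive_diagonal M s ->
  exists2 l : R, 0 < l & \prod_i sinkhorn_iter M k.+1 i (s i) @[k --> \oo] --> l.
Proof.
move=> M0 sM; pose d k := \prod_i sinkhorn_iter M k.+1 i (s i).
have d0 k : 0 < d k.
  by apply: prodr_gt0 => i _; have [_] := sinkhorn_positive k.+1 M0 sM; apply.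
have dS : {homo d : k m / (k <= m)%N >-> k <= m}.
  apply/nondecreasing_seqP => k; have [A0 sA] := sinkhorn_positive k.+1 M0 sM.
  have [r0 c0] := positive_diagonal_sums A0 sA.
  rewrite /d (sinkhorn_step s k M0 sM) ler_pdivlMr ?mulr_gt0 ?prodr_gt0//.
  by rewrite ler_piMr ?sums_prod_le1 ?(sinkhorn_total k M0 sM)// ltW// d0.
have dcvg : cvgn d.
  apply: nondecreasing_is_cvgn => //; exists 1 => _ [k _ <-].
  apply: prodr_ile1 => i; rewrite (sinkhorn_le1 _ _ _ M0 sM) andbT.
  by have [A0 _] := sinkhorn_positive k.+1 M0 sM.
exists (limn d) => //.
by apply: lt_le_trans (d0 0%N) _; exact: nondecreasing_cvgn_le.
Qed.

Lemma sinkhorn_sums_prod_cvg (R : realType) n (M : 'M[R]_n) (s : 'S_n) :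
  nonneg_mx M -> positive_diagonal M s ->
  sums_prod (sinkhorn_iter M k.+1) @[k --> \oo] --> (1 : R).
Proof.
move=> M0 sM; have [l l0 dl] := sinkhorn_diagonal_cvg M0 sM.
pose d k := \prod_i sinkhorn_iter M k.+1 i (s i).
have d0 k : d k != 0.
  rewrite gt_eqF//; apply: prodr_gt0 => i _.
  by have [_] := sinkhorn_positive k.+1 M0 sM; apply.
(* The divisor is a ratio of consecutive diagonal products, both tending to the same nonzero [l]. *)
have -> : (fun k => sums_prod (sinkhorn_iter M k.+1)) = (fun k => d k / d k.+1).
  apply/funext => k; rewrite /d (sinkhorn_step s k M0 sM) -/(d k).
  by rewrite invf_div mulrCA divff ?mulr1.
rewrite -(divff (lt0r_neq0 l0)).
apply: cvgM; first exact: dl.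
apply: cvgV; first exact: lt0r_neq0.
by rewrite (cvg_shiftS d).
Qed.

(** * Convergence along ultrafilters *)

Lemma ultra_pushforward T T' (f : T -> T') (U : set_system T) :
  UltraFilter U -> UltraFilter (f @ U).
Proof.
move=> UU; split=> [|G GF sUG]; first exact: fmap_proper_filter.
rewrite eqEsubset; split=> // A GA.
have [//|UnA] := in_ultra_setVsetC (f @^-1` A) UU.
have GnA : G (~` A) by exact: sUG.
by case: (@filter_not_empty _ G GF); rewrite -(setICr A); exact: filterI.
Qed.

(** Ultrafilters replace subsequences: if the preimage of a neighbourhood were not in [F], adjoining
    its complement would give a proper filter, and an ultrafilter above it would contradict the
    assumption. *)
Lemma cvg_ultra T (X : topologicalType) (f : T -> X) (F : set_system T) (x : X) :
  Filter F -> (forall U, UltraFilter U -> F `<=` U -> f @ U --> x) ->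
  f @ F --> x.
Proof.
move=> FF fU A xA; apply: contrapT => nFA.
pose G := within (~` (f @^-1` A)) F.
have GF : ProperFilter G.
  apply: Build_ProperFilter => G0.
  apply: (nFA : ~ F (f @^-1` A)); apply: (@filterS _ F _ _ _ _ G0) => t nA.
  exact: contrapT.
have [U [UU sGU]] := ultraFilterLemma GF.
have sFU : F `<=` U by apply: subset_trans sGU; exact: cvg_within.
have UA : U (f @^-1` A) by exact: fU.
have UnA : U (~` (f @^-1` A)) by apply: sGU; exact: withinT.
case: (@filter_not_empty _ U _); rewrite -(setICr (f @^-1` A)).
exact: filterI.
Qed.

Lemma mx_cvg (R : realType) T m n (F : set_system T) (u : T -> 'M[R]_(m, n))
    (L : 'M[R]_(m, n)) : Filter F ->
  (forall i j, u t i j @[t --> F] --> L i j) -> u @ F --> L.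
Proof.
(* A matrix neighbourhood contains a product of finitely many entry neighbourhoods. *)
move=> FF uL A [P LP PA]; apply: filterS (_ : (\forall t \near F, forall i j, P i j (u t i j))).
  by move=> t Pt; exact: PA.
apply: filter_forall => i; apply: filter_forall => j; exact: uL (LP i j).
Qed.

(** * Limits of the Sinkhorn iterates *)

(** The entries lie in the compact interval [[0, 1]], where every ultrafilter converges. *)
Lemma sinkhorn_ultra_cvg (R : realType) n (M : 'M[R]_n) (s : 'S_n) U :
  nonneg_mx M -> positive_diagonal M s -> UltraFilter U ->
  exists L : 'M[R]_n, forall i j, sinkhorn_iter M k.+1 i j @[k --> U] --> L i j.
Proof.
move=> M0 sM UU.
have H i j : exists l : R, sinkhorn_iter M k.+1 i j @[k --> U] --> l.
  have I01 k : `[0, 1] (sinkhorn_iter M k.+1 i j).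
    rewrite /= in_itv /= (sinkhorn_le1 _ _ _ M0 sM) andbT.
    by have [A0 _] := sinkhorn_positive k.+1 M0 sM.
  have := @segment_compact R 0 1; rewrite compact_ultra.
  move=> /(_ _ (ultra_pushforward (fun k => sinkhorn_iter M k.+1 i j) UU)).
  by case=> [|l [_ ?]]; [exact: (@filterE _ U)|exists l].
exists (\matrix_(i, j) sval (cid (H i j))) => i j; rewrite mxE.
by case: cid.
Qed.

Lemma sinkhorn_ultra_limit (R : realType) n (M L : 'M[R]_n) (s : 'S_n) U :
  nonneg_mx M -> positive_diagonal M s -> ProperFilter U -> \oo `<=` U ->
  (forall i j, sinkhorn_iter M k.+1 i j @[k --> U] --> L i j) ->
  doubly_stochastic L /\ exists2 x, 0 < x &
    forall t : 'S_n, \prod_i L i (t i) = x * \prod_i M i (t i).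
Proof.
move=> M0 sM UF ooU uL.
have sumL (I : finType) (f : I -> nat -> R) (l : I -> R) :
    (forall i, f i k @[k --> U] --> l i) -> \sum_i f i k @[k --> U] --> \sum_i l i.
  by move=> fl; apply: cvg_big => //; exact: add_continuous.
have prodL (I : finType) (f : I -> nat -> R) (l : I -> R) :
    (forall i, f i k @[k --> U] --> l i) -> \prod_i f i k @[k --> U] --> \prod_i l i.
  by move=> fl; apply: cvg_big => //; exact: mul_continuous.
have uniqU (f : nat -> R) (a b : R) : f @ U --> a -> f @ U --> b -> a = b.
  by move=> fa fb; exact: (cvg_unique (@norm_hausdorff _ R) fa fb).
split.
  apply: sums_prod_eq1.
  - move=> i j; apply: (cvgr_to_ge (uL i j)); apply: (@filterE _ U) => k.
    by have [] := sinkhorn_positive k.+1 M0 sM.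
  - apply: uniqU (sumL _ _ _ (fun i => sumL _ _ _ (uL i))) _.
    under eq_cvg do rewrite (sinkhorn_total _ M0 sM).
    exact: cvg_cst.
  - have q1 : sums_prod (sinkhorn_iter M k.+1) @[k --> U] --> (1 : R).
      by move=> A /(sinkhorn_sums_prod_cvg M0 sM)/ooU.
    apply: uniqU q1.
    apply: cvgM; apply: prodL => i; first exact: sumL.
    by apply: sumL => j; exact: uL.
have [l l0 dl] := sinkhorn_diagonal_cvg M0 sM.
have p0 : 0 < \prod_i M i (s i) by exact: prodr_gt0.
(* The factor comes from passing to the limit in the proportionality of diagonal products, with [s]
   as reference. *)
exists (l / \prod_i M i (s i)) => [|t]; first exact: divr_gt0.
apply: (mulIf (lt0r_neq0 p0)); rewrite mulrAC divfK ?lt0r_neq0//.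
have dl' : (\prod_i sinkhorn_iter M k.+1 i (t i)) * \prod_i M i (s i) @[k --> \oo]
     --> l * \prod_i M i (t i).
  under eq_cvg do rewrite (sinkhorn_proportional _ M0 sM).
  by apply: cvgM => //; exact: cvg_cst.
have dlU : (\prod_i sinkhorn_iter M k.+1 i (t i)) * \prod_i M i (s i) @[k --> U]
     --> l * \prod_i M i (t i).
  by move=> A /dl'/ooU.
apply: uniqU dlU.
by apply: cvgM; [apply: prodL => i; exact: uL|exact: cvg_cst].
Qed.

(** Convergence itself is proved here: [L] is one ultrafilter limit for [M], and uniqueness
    identifies it with every ultrafilter limit for either matrix. *)
Lemma sinkhorn_cvg_common (R : realType) n (M M' : 'M[R]_n) (s : 'S_n) :
  nonneg_mx M -> nonneg_mx M' -> positive_diagonal M s ->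
  (forall t : 'S_n, \prod_i M i (t i) = \prod_i M' i (t i)) ->
  exists L : 'M[R]_n, sinkhorn_iter M @ \oo --> L /\ sinkhorn_iter M' @ \oo --> L.
Proof.
move=> M0 M'0 sM MM'.
have sM' : positive_diagonal M' s.
  by apply/positive_diagonalE => //; rewrite -MM'; exact/positive_diagonalE.
have [U [UU ooU]] := ultraFilterLemma (eventually_filter).
have [L uL] := sinkhorn_ultra_cvg M0 sM UU.
have [dL [x x0 Lx]] := sinkhorn_ultra_limit M0 sM _ ooU uL.
have cvgL (N : 'M[R]_n) : nonneg_mx N -> positive_diagonal N s ->
    (forall t : 'S_n, \prod_i M i (t i) = \prod_i N i (t i)) ->
    sinkhorn_iter N @ \oo --> L.
  move=> N0 sN MN; rewrite -cvg_shiftS; apply: cvg_ultra => V VU ooV.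
  have [L' uL'] := sinkhorn_ultra_cvg N0 sN VU.
  have [dL' [y y0 Ly]] := sinkhorn_ultra_limit N0 sN _ ooV uL'.
  have -> : L = L'.
    apply: (@doubly_stochastic_eq _ _ _ _ (y / x)) => // [|t]; first exact: divr_gt0.
    by rewrite Ly Lx mulrA divfK ?lt0r_neq0// MN.
  exact: mx_cvg.
by exists L; split; exact: cvgL.
Qed.

(** * Off-diagonal changes preserve the diagonal products *)

Lemma off_diagonal_prod (R : realType) n (M M' : 'M[R]_n) (t : 'S_n) :
  (forall i j, M' i j <> M i j ->
     off_diagonal M i j /\ off_diagonal M' i j) ->
  positive_diagonal M t -> \prod_i M i (t i) = \prod_i M' i (t i).
Proof.
move=> MM' tM; apply: eq_bigr => i _; apply: contrapT => /nesym/MM'[+ _].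
by apply; exists t.
Qed.

Theorem proposition21 (R : realType) (n : nat) (n_gt0 : (0 < n)%N)
    (M M' : 'M[R]_n) (AM : class_A M) (AM' : class_A M')
    (changes_off_diagonal : forall s t : 'I_n, M' s t <> M s t ->
       off_diagonal M s t /\ off_diagonal M' s t) :
  Phi M' = Phi M /\ CI M' = CI M.
Proof.
have [M0 _ [s sM]] := AM; have [M'0 _ _] := AM'.
have MM' (t : 'S_n) : \prod_i M i (t i) = \prod_i M' i (t i).
  have [tM|ntM] := pselect (positive_diagonal M t).
    exact: off_diagonal_prod.
  have [tM'|ntM'] := pselect (positive_diagonal M' t).
    apply/esym/off_diagonal_prod => // i j /nesym/changes_off_diagonal[]//.
  (* A diagonal positive in neither matrix has product 0 in both, by nonnegativity. *)
  have z (A : 'M[R]_n) : nonneg_mx A -> ~ positive_diagonal A t ->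
      \prod_i A i (t i) = 0.
    move=> A0 nA; apply/eqP; rewrite eq_le prodr_ge0// andbT leNgt.
    by apply/negP => /(positive_diagonalE t A0).
  by rewrite !z.
have [L [ML M'L]] := sinkhorn_cvg_common M0 M'0 sM MM'.
have P : Phi M' = Phi M.
  (* Convergence being known, [lim] is the true limit and not its default value. *)
  by rewrite /Phi (cvg_lim _ ML) ?(cvg_lim _ M'L)//; exact: norm_hausdorff.
by rewrite /CI P.
Qed.
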